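(* Let $\mathbf c=(c[1],c[2])\in\mathbb N^2$ with $c[1],c[2]\ge 1$. Define $$S^1(\mathbf c)=\{T_E=(p): E=\{M_1,M_2\},\ M_i\in \mathrm{Cond}^*(c[i])\ (i=1,2),\ 1\le p\le \min(\mathrm{Comp}(M_1,M_2),l(M_1),l(M_2))\};$$ for $1\le k<c[2]$, $$I_1(k)=\{T_E=(p): E=\{M_1,M_2\},\ M_1\in\mathrm{Cond}^*(c[1]),\ M_2\in\mathrm{Cond}^*(k),\ p=l(M_2)+c[2]-k\le\min(l(M_1),\mathrm{Comp}(M_1,M_2))\};$$ for $1\le k<c[1]$, $$I_2(k)=\{T_E=(p): E=\{M_1,M_2\},\ M_1\in\mathrm{Cond}^*(k),\ M_2\in\mathrm{Cond}^*(c[2]),\ p=l(M_1)+c[1]-k\le\min(l(M_2),\mathrm{Comp}(M_1,M_2))\};$$ and for $1\le k_1<c[1]$, $1\le k_2<c[2]$, $$I(k_1,k_2)=\{T_E=(p): E=\{M_1,M_2\},\ M_i\in\mathrm{Cond}^*(k_i)\ (i=1,2),\ p=l(M_1)+c[1]-k_1=l(M_2)+c[2]-k_2\le \mathrm{Comp}(M_1,M_2)\}.$$ Put $$S^2_1(\mathbf c)=\bigcup_{k=1}^{c[2]-1}I_1(k),\qquad S^2_2(\mathbf c)=\bigcup_{k=1}^{c[1]-1}I_2(k),\qquad S^3(\mathbf c)=\bigcup_{1\le k_1<c[1],\ 1\le k_2<c[2]}I(k_1,k_2).$$ Then $$\mathrm{Cond}(\mathbf c)=S^1(\mathbf c)\cup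 S^2_1(\mathbf c)\cup S^2_2(\mathbf c)\cup S^3(\mathbf c).$$
   Context: $\mathbb N$ contains $0$, $\mathbb N^*=\mathbb N\setminus\{0\}$; $v[i]$ is the $i$-th component of a vector (or sequence) $v$; $\mathbb N^r$ has the componentwise partial order. Multiplicity sequences. A multiplicity sequence is a nonincreasing sequence $M=\{m_n\}_{n\ge1}$ in $\mathbb N^*$, eventually equal to $1$, such that for every $n\ge1$ there is $s(n)\ge n+1$ with $m_n=\sum_{k=n+1}^{s(n)}m_k$. If $M$ is not constant it is written $M=[m_1,\ldots,m_k]$ with $m_k$ the last entry different from $1$; the constant sequence is written $[1]$. The number $k$ of entries of this vector is the length $l(M)$ (so $l([1])=1$). A numerical semigroup $S$ (submonoid of $\mathbb N$ with finite complement) is Arf if $\{n\in S:n\ge s\}-s$ is a semigroup for each $s\in S$; Arf numerical semigroups correspond bijectively to multiplicity sequences via $M=[m_1,\ldots,m_k]\mapsto \{0,m_1,m_1+m_2,\ldots,m_1+\cdots+m_k\}\cup\{n: n>m_1+\cdots+m_k\}$ (with $[1]\mapsto\mathbb N$). For $n\in\mathbb N$, $\mathrm{Cond}(n)$ is the set of multiplicity sequences of Arf numerical semigroups with conductor $n$ (the conductor being the least $c$ such that all integers $\ge c$ lie in the semigroup). For $c\in\mathbb N^*$, $\mathrm{Cond}^*(c)=\mathrm{Cond}(c)$ if $c\ne1$ and $\mathrm{Cond}^*(1)=\mathrm{Cond}(0)=\{[1]\}$. Compatibility. For a multiplicity sequence $M_i$ and $k\ge1$ let $s_{i,k}$ be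 the integer with $M_i[k]=\sum_{l=k+1}^{s_{i,k}}M_i[l]$. For $M_1\ne M_2$, $\mathrm{Comp}(M_1,M_2)=\min\{\min(s_{1,k},s_{2,k}): k\ge 1,\ s_{1,k}\ne s_{2,k}\}$; if $M_1=M_2$, $\mathrm{Comp}(M_1,M_2)=+\infty$. Good semigroups. A good semigroup $S\subseteq\mathbb N^r$ is a submonoid such that: (1) $\min(a,b)\in S$ (componentwise) for $a,b\in S$; (2) if $a,b\in S$ and $a[i]=b[i]$, there is $c\in S$ with $c[i]>a[i]$, $c[j]\ge\min(a[j],b[j])$ for $j\ne i$, with equality if $a[j]\ne b[j]$; (3) there is $\delta\in S$ with $\delta+\mathbb N^r\subseteq S$. Its conductor is the minimal vector $\mathbf c$ with $\mathbf c+\mathbb N^r\subseteq S$. All good semigroups considered are local: the zero vector is the only element with some zero component. $S$ is Arf if $\{\beta\in S:\beta\ge\alpha\}-\alpha$ is a semigroup for every $\alpha\in S$. Multiplicity trees. A local Arf good semigroup $S\subseteq \mathbb N^r$ is determined by its multiplicity tree $T$: a rooted tree with $r$ infinite branches, whose nodes are vectors $\mathbf n_i^j\in\mathbb N^r$ ($\mathbf n_i^j$ is the node of the $i$-th branch at level $j\ge1$; all branches share the root $\mathbf n_1^1$), with $S=\{\mathbf 0\}\cup\{\sum_{\mathbf n\in T'}\mathbf n : T' \text{ a finite subtree of } T \text{ rooted in } \mathbf n_1^1\}$. A tree is a multiplicity tree of a local Arf good semigroup iff: there is $L$ such that for $m\ge L$, $\mathbf n_i^m$ is the $i$-th unit vector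 for all $i$; $\mathbf n_i^j[h]=0$ iff $\mathbf n_i^j$ is not in the $h$-th branch; and each $\mathbf n_i^j$ is the sum of the (other) nodes of a finite subtree rooted in $\mathbf n_i^j$, i.e. $\mathbf n_i^j$ equals the sum of the nodes different from $\mathbf n_i^j$ of such a subtree. Two branches are glued at level $j$ if they share their node at level $j$. The sequence $M_i[j]=\mathbf n_i^j[i]$ is a multiplicity sequence. For $r=2$, a multiplicity tree is described by the ordered collection $E=\{M_1,M_2\}$ of the multiplicity sequences along its branches and the highest level $p\ge1$ at which the two branches are glued; it is denoted $T_E=(p)$. $\mathrm{Cond}(\mathbf c)$, for $\mathbf c\in\mathbb N^2$, is the set of all multiplicity trees of local Arf good semigroups in $\mathbb N^2$ with conductor $\mathbf c$ (for $r=2$ every tree is untwisted). *)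

(* Defs.v *)
From mathcomp Require Import all_boot all_order all_algebra finmap.
From mathcomp Require Import boolp classical_sets cardinality.

Set Implicit Arguments.
Unset Strict Implicit.
Unset Printing Implicit Defensive.

Import GRing.Theory.

Local Open Scope classical_set_scope.
Local Open Scope nat_scope.

(* Sequences and branches are indexed from 1.  The function [u : nat -> A]
   stores the [n]-th term ([n >= 1]) at argument [n.-1], so that Leibniz
   equality of functions is equality of sequences; [ent u 0] is
   meaningless. *)
Definition ent (A : Type) (u : nat -> A) (n : nat) : A := u n.-1.

Definition is_least (A : set nat) (m : nat) : Prop :=
  A m /\ forall n, A n -> m <= n.

(* The minimum of a nonempty set of naturals (0 if the set is empty). *)
Definition nat_min (A : set nat) : nat := xget 0 (is_least A).

Record mult_seq (M : nat -> nat) : Prop := MultSeq {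
  mult_seq_gt0 : forall n, 1 <= n -> 0 < ent M n;
  mult_seq_noninc : forall n, 1 <= n -> ent M n.+1 <= ent M n;
  mult_seq_ev1 : exists N, forall n, N <= n -> ent M n = 1;
  mult_seq_sum : forall n, 1 <= n ->
    exists2 s, n.+1 <= s & ent M n = \sum_(n.+1 <= k < s.+1) ent M k
}.

(* The index of the last entry different from 1; the default value 1 is
   reached exactly by the constant sequence [1]. *)
Definition len (M : nat -> nat) : nat :=
  xget 1 [set k | [/\ 1 <= k, ent M k <> 1 & forall j, k < j -> ent M j = 1]].

(* The integer s_k; it is unique because the entries are positive. *)
Definition sum_index (M : nat -> nat) (k : nat) : nat :=
  xget 0 [set s | k.+1 <= s /\ ent M k = \sum_(k.+1 <= l < s.+1) ent M l].

(* [None] stands for +oo. *)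
Definition Comp (M1 M2 : nat -> nat) : option nat :=
  if `[< M1 = M2 >] then None
  else Some (nat_min
    [set m | exists k, [/\ 1 <= k, sum_index M1 k <> sum_index M2 k
                         & m = minn (sum_index M1 k) (sum_index M2 k)]]).

Definition le_oo (p : nat) (x : option nat) : bool :=
  if x is Some m then p <= m else true.

Definition submonoid (V : nmodType) (S : set V) : Prop :=
  S 0%R /\ forall x y, S x -> S y -> S (x + y)%R.

(* For V = nat or N^r, [set g | S (a + g)] is {b in S : b >= a} - a. *)
Definition Arf (V : nmodType) (S : set V) : Prop :=
  forall a, S a -> submonoid [set g | S (a + g)%R].

Definition numerical_semigroup (S : set nat) : Prop :=
  submonoid S /\ finite_set (~` S).

Definition is_num_conductor (S : set nat) : nat -> Prop :=
  is_least [set c | forall n, c <= n -> S n].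

Definition partial_sum (M : nat -> nat) (j : nat) : nat :=
  \sum_(1 <= l < j.+1) ent M l.

(* For the constant sequence this is {0, 1} together with all n > 1, i.e. N. *)
Definition semigroup_of_seq (M : nat -> nat) : set nat :=
  [set n | (exists2 j, j <= len M & n = partial_sum M j)
           \/ partial_sum M (len M) < n].

Definition mult_seq_of (S : set nat) (M : nat -> nat) : Prop :=
  mult_seq M /\ S = semigroup_of_seq M.

Definition CondN (n : nat) : set (nat -> nat) :=
  [set M | exists S, [/\ numerical_semigroup S, Arf S, is_num_conductor S n
                       & mult_seq_of S M]].

Definition CondN_star (c : nat) : set (nat -> nat) :=
  if c == 1 then CondN 0 else CondN c.

(* In [good_exchange], the case a = b is allowed; it follows from
   [good_conductor]. *)
Record good_semigroup (r : nat) (S : set 'rV[nat]_r) : Prop := GoodSemigroup {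
  good_submonoid : submonoid S;
  good_min : forall a b, S a -> S b -> S (map2_mx minn a b);
  good_exchange : forall a b i, S a -> S b -> a ord0 i = b ord0 i ->
    exists c, [/\ S c, a ord0 i < c ord0 i
      & forall j, j != i ->
          minn (a ord0 j) (b ord0 j) <= c ord0 j /\
          (a ord0 j <> b ord0 j -> c ord0 j = minn (a ord0 j) (b ord0 j))];
  good_conductor : exists d, S d /\ forall g, S (d + g)%R
}.

Definition local_semigroup (r : nat) (S : set 'rV[nat]_r) : Prop :=
  forall x, S x -> (exists i, x ord0 i = 0) -> x = 0%R.

(* The vectors c with c + N^r contained in a good semigroup are closed under
   componentwise minimum, so the minimal one is the least one. *)
Definition is_conductor (r : nat) (S : set 'rV[nat]_r) (c : 'rV[nat]_r) : Prop :=
  (forall g, S (c + g)%R) /\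
  forall d, (forall g, S (d + g)%R) -> forall i, c ord0 i <= d ord0 i.

(* [ent (T i) j] is the node of the i-th branch at level j.  A node is
   identified by its level and its vector: in a multiplicity tree, distinct
   nodes at the same level have distinct vectors, since the i-th component of
   a node is nonzero exactly when the node lies on the i-th branch.  Thus the
   branches i and h are glued at level j iff [ent (T i) j = ent (T h) j]. *)
Definition tree (r : nat) := 'I_r -> nat -> 'rV[nat]_r.

Definition node (r : nat) (T : tree r) (i : 'I_r) (j : nat) :
  nat * 'rV[nat]_r := (j, ent (T i) j).

(* Finite subtree of T rooted in the node of branch i at level j: every node
   other than the root is a node of T below level j whose parent is in N. *)
Definition subtree (r : nat) (T : tree r) (i : 'I_r) (j : nat)
    (N : {fset nat * 'rV[nat]_r}) : Prop :=
  node T i j \in N /\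
  forall x, x \in N -> x <> node T i j ->
    exists h k, [/\ j <= k, x = node T h k.+1 & node T h k \in N].

Record mult_tree (r : nat) (T : tree r) : Prop := MultTree {
  tree_root : forall i h, ent (T i) 1 = ent (T h) 1;
  tree_glue : forall i h j, 1 <= j ->
    ent (T i) j.+1 = ent (T h) j.+1 -> ent (T i) j = ent (T h) j;
  tree_unit : exists L, forall m, L <= m ->
    forall i, ent (T i) m = delta_mx ord0 i;
  tree_zero : forall i h j, 1 <= j ->
    (ent (T i) j ord0 h = 0 <-> ent (T i) j <> ent (T h) j);
  tree_sum : forall i j, 1 <= j ->
    exists2 N, subtree T i j N
      & ent (T i) j = (\sum_(x <- N | x != node T i j) x.2)%R
}.

Definition semigroup_of_tree (r : nat) (T : tree r) : set 'rV[nat]_r :=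
  [set v | v = 0%R \/
     exists i N, subtree T i 1 N /\ v = (\sum_(x <- N) x.2)%R].

Definition mult_tree_of (r : nat) (S : set 'rV[nat]_r) (T : tree r) : Prop :=
  mult_tree T /\ S = semigroup_of_tree T.

Definition Cond (r : nat) (c : 'rV[nat]_r) : set (tree r) :=
  [set T | exists S, [/\ good_semigroup S, local_semigroup S, Arf S,
                         is_conductor S c & mult_tree_of S T]].

(* The tree T_E = (p) with E = {M1, M2}: the two branches share the nodes
   (M1[j], M2[j]) for j <= p; for j > p their nodes are (M1[j], 0) and
   (0, M2[j]).  The branches 1 and 2 are [ord0] and [ord_max] in ['I_2]; the
   argument [j0] stands for the level j = j0.+1, as in [ent]. *)
Definition tree2 (M1 M2 : nat -> nat) (p : nat) : tree 2 :=
  fun i j0 => (\row_(h < 2)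
    if (j0.+1 <= p)%N || (h == i) then (if h == ord0 then M1 j0 else M2 j0)
    else 0)%R.

Section Families.
Variable c : 'rV[nat]_2.
Let c1 := c ord0 ord0.
Let c2 := c ord0 ord_max.

Definition S1 : set (tree 2) :=
  [set T | exists M1 M2 p,
     [/\ T = tree2 M1 M2 p, CondN_star c1 M1, CondN_star c2 M2, 1 <= p
       & [/\ le_oo p (Comp M1 M2), p <= len M1 & p <= len M2]]].

Definition I1 (k : nat) : set (tree 2) :=
  [set T | exists M1 M2 p,
     [/\ T = tree2 M1 M2 p, CondN_star c1 M1, CondN_star k M2,
         p = len M2 + (c2 - k)
       & p <= len M1 /\ le_oo p (Comp M1 M2)]].

Definition I2 (k : nat) : set (tree 2) :=
  [set T | exists M1 M2 p,
     [/\ T = tree2 M1 M2 p, CondN_star k M1, CondN_star c2 M2,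
         p = len M1 + (c1 - k)
       & p <= len M2 /\ le_oo p (Comp M1 M2)]].

Definition I12 (k1 k2 : nat) : set (tree 2) :=
  [set T | exists M1 M2 p,
     [/\ T = tree2 M1 M2 p, CondN_star k1 M1, CondN_star k2 M2,
         p = len M1 + (c1 - k1)
       & p = len M2 + (c2 - k2) /\ le_oo p (Comp M1 M2)]].

Definition S21 : set (tree 2) := \bigcup_(k in [set k | 1 <= k < c2]) I1 k.

Definition S22 : set (tree 2) := \bigcup_(k in [set k | 1 <= k < c1]) I2 k.

Definition S3 : set (tree 2) :=
  \bigcup_(k1 in [set k | 1 <= k < c1]) \bigcup_(k2 in [set k | 1 <= k < c2])
    I12 k1 k2.

End Families.

(* Main.v *)
(* The branch sequences of a multiplicity tree T in N^2 and its gluing level p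
   determine T = tree2 M1 M2 p.  Counting the nodes that a finite subtree has on
   each branch identifies the semigroup of T with the pairs of partial sums
   (P1 a, P2 b) where a = b or both a, b >= p, and turns the sum condition at the
   glued levels into p <= Comp M1 M2.  A conductor component c[i] is therefore
   Pi (max p (len Mi)): it equals the conductor of Mi when p <= len Mi, and
   exceeds it by p - len Mi otherwise.  The two alternatives for each of i = 1, 2
   give the four families.  The uniform description of CondN_star c (c >= 1) is
   that the partial sum of M up to len M is c, which covers the sequence [1] at
   c = 1. *)
Require Import Defs.
From mathcomp Require Import all_boot all_order all_algebra finmap zify.
From mathcomp Require Import boolp classical_sets cardinality.

Set Implicit Arguments.
Unset Strict Implicit.
Unset Printing Implicit Defensive.

Import GRing.Theory.

Local Open Scope classical_set_scope.
Local Open Scope nat_scope.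

(** * Partial sums of sequences and of their tails *)

(** The proofs use the 0-based argument throughout: [M l] is the entry of index l + 1, so [tail M n]
    consists of the entries after the n-th. *)
Definition tail (M : nat -> nat) (n : nat) : nat -> nat := fun l => M (n + l).

Lemma partial_sumE M j : partial_sum M j = \sum_(l < j) M l.
Proof. by rewrite /partial_sum big_add1 /= big_mkord. Qed.

Lemma partial_sum0 M : partial_sum M 0 = 0.
Proof. by rewrite partial_sumE big_ord0. Qed.

Lemma partial_sumS M j : partial_sum M j.+1 = partial_sum M j + M j.
Proof. by rewrite !partial_sumE big_ord_recr. Qed.

Lemma partial_sum_tail M j k :
  partial_sum M (j + k) = partial_sum M j + partial_sum (tail M j) k.
Proof.
elim: k => [|k IH]; first by rewrite partial_sum0 !addn0.
by rewrite addnS !partial_sumS IH addnA.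
Qed.

Lemma partial_sum_cons M j :
  partial_sum M j.+1 = M 0 + partial_sum (tail M 1) j.
Proof. by rewrite -add1n partial_sum_tail partial_sumS partial_sum0. Qed.

Lemma tail_partial_sum_cons M n j :
  partial_sum (tail M n) j.+1 = M n + partial_sum (tail M n.+1) j.
Proof.
rewrite partial_sum_cons {1}/tail addn0; congr (_ + partial_sum _ _).
by apply: funext => l; rewrite /tail add1n addnS addSn.
Qed.

Lemma leq_partial_sum M j k : j <= k -> partial_sum M j <= partial_sum M k.
Proof. by move=> /subnKC <-; rewrite partial_sum_tail leq_addr. Qed.

Lemma ltn_partial_sum M j k : (forall n, 0 < M n) ->
  (partial_sum M j < partial_sum M k) = (j < k).
Proof.
move=> M0; case: (ltnP j k) => [jk|kj]; last by rewrite ltnNge leq_partial_sum.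
by apply: (leq_trans _ (leq_partial_sum M jk)); rewrite partial_sumS -addn1 leq_add2l.
Qed.

Lemma partial_sum_inj M : (forall n, 0 < M n) -> injective (partial_sum M).
Proof.
move=> M0 j k jk; have := ltn_partial_sum j k M0; have := ltn_partial_sum k j M0.
by rewrite jk ltnn; lia.
Qed.

(** Translates the 1-based sums in [mult_seq] and [sum_index] into partial sums of a tail; t is the
    number of summands. *)
Lemma partial_sum_window M n t :
  \sum_(n.+2 <= k < (n.+1 + t).+1) ent M k = partial_sum (tail M n.+1) t.
Proof.
elim: t => [|t IH]; first by rewrite addn0 partial_sum0 big_geq.
by rewrite addnS big_nat_recr ?IH ?partial_sumS //; lia.
Qed.

Lemma mult_seq_pos M : mult_seq M -> forall n, 0 < M n.
Proof. by move=> hM n; apply: (mult_seq_gt0 hM (n := n.+1)). Qed.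

(** * Multiplicity sequences, compatibility and length *)

Lemma mult_seqP M : mult_seq M <->
  [/\ forall n, 0 < M n, exists N, forall n, N <= n -> M n = 1
    & forall n, exists t, M n = partial_sum (tail M n.+1) t].
Proof.
split=> [hM|[M0 [N HN] Ms]].
  split; first exact: mult_seq_pos.
    have [N HN] := mult_seq_ev1 hM; exists N => n Nn.
    by apply: (HN n.+1); lia.
  move=> n; have [s ns Mn] := mult_seq_sum hM (n := n.+1) isT.
  by exists (s - n.+1); rewrite -partial_sum_window subnKC ?(ltnW ns).
(* Positivity forces at least one summand. The first one is the next entry, which gives
   monotonicity. *)
have Ms1 n : exists2 t, 0 < t & M n = partial_sum (tail M n.+1) t.
  have [[|t] Mt] := Ms n; last by exists t.+1.
  by have := M0 n; rewrite Mt partial_sum0.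
split.
- by move=> n _; apply: M0.
- move=> [|n] // _; have [[|t] // _] := Ms1 n.
  by rewrite /ent /= => ->; rewrite tail_partial_sum_cons leq_addr.
- by exists N.+1 => -[|n] // /HN.
- move=> [|n] // _; have [t t0 Mt] := Ms1 n.
  by exists (n.+1 + t); [lia | rewrite partial_sum_window].
Qed.

Lemma mult_seq_tail M n : mult_seq M -> mult_seq (tail M n).
Proof.
move=> /mult_seqP [M0 [N HN] Ms]; apply/mult_seqP; split.
- by move=> k; apply: M0.
- by exists N => k Nk; apply: HN; lia.
- move=> k; have [t Mt] := Ms (n + k); exists t; rewrite /tail Mt.
  by congr partial_sum; apply: funext => l; rewrite /tail; congr M; lia.
Qed.

Lemma sum_index_eq M n t : (forall n, 0 < M n) ->
  M n = partial_sum (tail M n.+1) t -> sum_index M n.+1 = n.+1 + t.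
Proof.
move=> M0 Mt; apply: xget_unique.
  split; last by rewrite partial_sum_window.
  by case: t Mt => [|t]; [have := M0 n; rewrite partial_sum0; lia | lia].
move=> s [ns]; rewrite -(subnKC (ltnW ns)) partial_sum_window.
rewrite [ent _ _]Mt => /partial_sum_inj -> // l; exact: M0.
Qed.

Lemma sum_indexP M n : mult_seq M ->
  exists2 t, sum_index M n.+1 = n.+1 + t & M n = partial_sum (tail M n.+1) t.
Proof.
move=> hM; have /mult_seqP [M0 _ /(_ n) [t Mt]] := hM.
by exists t => //; apply: sum_index_eq.
Qed.

(** Both sequences are 1 from N1 + N2 on. Going down from there, each entry is a sum of later
    entries, and equal indices mean equally many summands. *)
Lemma eq_mult_seq M1 M2 : mult_seq M1 -> mult_seq M2 ->
  (forall k, 1 <= k -> sum_index M1 k = sum_index M2 k) -> M1 = M2.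
Proof.
move=> h1 h2 s12.
have [/mult_seqP[_ [N1 HN1] _] /mult_seqP[_ [N2 HN2] _]] := (h1, h2).
have Mk k : forall n, N1 + N2 <= n + k -> M1 n = M2 n.
  elim: k => [|k IH] n nk; first by rewrite HN1 ?HN2 //; lia.
  have [t1 e1 ->] := sum_indexP n h1; have [t2 e2 ->] := sum_indexP n h2.
  have -> : t1 = t2 by have := s12 n.+1 isT; rewrite e1 e2 => /addnI.
  rewrite !partial_sumE; apply: eq_bigr => l _; apply: IH; lia.
by apply: funext => n; apply: (Mk (N1 + N2)); lia.
Qed.

Lemma nat_min_least (A : set nat) : (exists m, A m) -> is_least A (nat_min A).
Proof.
move=> [m Am]; rewrite /nat_min.
have exA : exists m, `[< A m >] by exists m; apply/asboolP.
have : is_least A (ex_minn exA).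
  case: ex_minnP => k /asboolP Ak kmin; split=> // n An.
  by apply: kmin; apply/asboolP.
by move=> lA; apply: xgetPex; exists (ex_minn exA).
Qed.

(** For distinct sequences some indices differ, by [eq_mult_seq], so [nat_min] is a true minimum and
    not its default value 0. *)
Lemma le_oo_CompP M1 M2 p : mult_seq M1 -> mult_seq M2 ->
  le_oo p (Comp M1 M2) <->
  forall k, 1 <= k -> sum_index M1 k <> sum_index M2 k ->
    p <= minn (sum_index M1 k) (sum_index M2 k).
Proof.
move=> h1 h2; rewrite /Comp; case: asboolP => [-> //|neq] /=.
have [|[k [k1 sk ->]] kmin] := @nat_min_least
    [set m | exists k, [/\ 1 <= k, sum_index M1 k <> sum_index M2 k
                         & m = minn (sum_index M1 k) (sum_index M2 k)]].
  apply: contrapT => no; apply/neq/eq_mult_seq => // k k1.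
  by apply: contrapT => sk; apply: no; exists (minn (sum_index M1 k) (sum_index M2 k)), k.
split=> [pk l l1 sl|]; last exact.
by apply: (leq_trans pk); apply: kmin; exists l.
Qed.

Lemma len_spec M : mult_seq M ->
  [/\ 1 <= len M, forall n, len M <= n -> M n = 1
    & len M = 1 \/ ent M (len M) <> 1].
Proof.
move=> /mult_seqP[_ [N HN] _]; rewrite /len; case: xgetP => [_ -> [k1 kn1 kj]|no].
  split=> //; last by right.
  by move=> n kn; apply: (kj n.+1).
split=> //; last by left.
(* Positions of entries different from 1 are bounded by N, so if there were any, a last one would
   exist. *)
move=> n _; apply: contrapT => Mn.
have exk : exists k, M k != 1 by exists n; apply/eqP.
have bk k : M k != 1 -> k <= N.
  by rewrite leqNgt; apply: contra => /ltnW /HN ->.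
have [m /eqP Mm mmax] := ex_maxnP exk bk.
apply: (no m.+1); split=> // -[//|j] mj; apply/eqP; apply: contraLR mj => /mmax.
by rewrite -leqNgt ltnS.
Qed.

Lemma partial_sum_len M j : mult_seq M -> len M <= j ->
  partial_sum M j = partial_sum M (len M) + (j - len M).
Proof.
move=> /len_spec[_ M1 _] lj; rewrite -{1}(subnKC lj) partial_sum_tail; congr addn.
rewrite partial_sumE (eq_bigr (fun=> 1)) ?sum1_card ?card_ord // => i _.
by apply: M1; apply: leq_addr.
Qed.

(** An entry above 1 leaves a gap: the predecessor of the partial sum up to it lies strictly between
    two consecutive partial sums. *)
Lemma partial_sum_gap M l j : (forall n, 0 < M n) -> 1 <= l -> ent M l <> 1 ->
  (partial_sum M l).-1 <> partial_sum M j.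
Proof.
case: l => [//|l] M0 _; rewrite /ent /= => Ml lj.
have Ml0 := M0 l; have lS := partial_sumS M l.
have : partial_sum M j < partial_sum M l.+1 by lia.
have : partial_sum M l < partial_sum M j by lia.
rewrite !ltn_partial_sum //; lia.
Qed.

(** Minimality of the conductor on one branch. Taking g = 0 bounds d below by [partial_sum M p]; if
    p < [len M], a smaller d would let some g reach the gap just below [partial_sum M (len M)]. *)
Lemma partial_sum_len_le M p d : mult_seq M -> 1 <= p ->
  (forall g, exists2 j, p <= j & d + g = partial_sum M j) ->
  partial_sum M (maxn p (len M)) <= d.
Proof.
move=> hM p1 H.
have pd : partial_sum M p <= d.
  by have [j /(leq_partial_sum M) + dj] := H 0; rewrite -dj addn0.
case: (leqP (len M) p) => [//|pl].
rewrite leqNgt; apply/negP => dl.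
have [_ _ [l1|l1]] := len_spec hM; first lia.
have [j _ dj] := H ((partial_sum M (len M)).-1 - d).
apply: (@partial_sum_gap M (len M) j (mult_seq_pos hM)) => //; lia.
Qed.

(** * Arf semigroups and conductors of multiplicity sequences *)

(* The semigroup of multiplicity [m] whose blow-up is [S]. *)
Definition cons_semigroup (V : nmodType) (m : V) (S : set V) : set V :=
  [set v | v = 0%R \/ exists2 x, S x & v = (m + x)%R].

Lemma Arf_submonoid (V : nmodType) (S : set V) : S 0%R -> Arf S -> submonoid S.
Proof.
move=> S0 /(_ _ S0) [_ SD]; split=> // x y Sx Sy.
by have := SD x y; rewrite /= !add0r; apply.
Qed.

(** The translate at m + a' is the translate of S at a'. At 0, closure comes from m being in S: (m +
    x) + (m + y) = m + (x + (m + y)). *)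
Lemma Arf_cons_semigroup (V : nmodType) (m : V) (S : set V) :
  left_injective (fun x y : V => x + y)%R ->
  (forall x y : V, x + y = 0 -> y = 0)%R -> Arf S -> S 0%R -> S m ->
  Arf (cons_semigroup m S).
Proof.
move=> addI add_eq0 ArfS S0 Sm; have [_ SD] := Arf_submonoid S0 ArfS.
have subI (x y z : V) : (x + y = x + z)%R -> y = z.
  by rewrite ![(x + _)%R]addrC => /addI.
have consD x y : S x -> S y -> cons_semigroup m S (m + x + (m + y))%R.
  move=> Sx Sy; right; exists (x + (m + y))%R; last by rewrite -addrA.
  exact: (SD _ _ Sx (SD _ _ Sm Sy)).
move=> a [->|[a' Sa ->]].
  split=> [|x y]; rewrite /= ?addr0 ?add0r; first by left.
  move=> [->|[x' Sx ->]] [->|[y' Sy ->]]; rewrite ?addr0 ?add0r.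
  - by left.
  - by right; exists y'.
  - by right; exists x'.
  - exact: consD.
have shiftP x : cons_semigroup m S (m + a' + x)%R <-> S (a' + x)%R.
  split=> [[|[y Sy]]|Sx]; rewrite -addrA; last by right; exists (a' + x)%R.
    by move=> /add_eq0 ->.
  by move=> /subI ->.
have [A0 AD] := ArfS _ Sa; split=> [|x y]; first exact/shiftP.
by move=> /shiftP Sx /shiftP Sy; apply/shiftP/AD.
Qed.

(* On a constant sequence the set is all of N; each earlier entry blows it down
   once, so the number of entries that may exceed 1 is the induction parameter. *)
Lemma Arf_partial_sums M : mult_seq M -> Arf [set n | exists j, n = partial_sum M j].
Proof.
move=> hM; have /mult_seqP [_ [N HN] _] := hM.
elim: N M hM HN => [|N IH] M hM HN.
  suff -> : [set n | exists j, n = partial_sum M j] = setT by [].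
  apply/seteqP; split=> // n _; exists n; rewrite partial_sumE.
  by rewrite (eq_bigr (fun=> 1)) ?sum1_card ?card_ord // => i _; apply: HN.
have -> : [set n | exists j, n = partial_sum M j] =
    cons_semigroup (M 0) [set n | exists j, n = partial_sum (tail M 1) j].
  apply/seteqP; split=> [n [[|j] ->]|n [->|[x [j ->] ->]]].
  - by left; rewrite partial_sum0.
  - by right; exists (partial_sum (tail M 1) j); [exists j | rewrite partial_sum_cons].
  - by exists 0; rewrite partial_sum0.
  - by exists j.+1; rewrite partial_sum_cons.
apply: Arf_cons_semigroup.
- by move=> x y z /addIn.
- by move=> x y /eqP; rewrite addn_eq0 => /andP[_ /eqP].
- by apply: IH; [exact: mult_seq_tail | move=> n Nn; apply: HN; lia].
- by exists 0; rewrite partial_sum0.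
- by have /mult_seqP [_ _ /(_ 0)] := hM.
Qed.

Lemma semigroup_of_seqE M : mult_seq M ->
  semigroup_of_seq M = [set n | exists j, n = partial_sum M j].
Proof.
move=> hM; apply/seteqP; split=> n.
  move=> [[j _ ->]|ln]; first by exists j.
  exists (len M + (n - partial_sum M (len M))).
  by rewrite partial_sum_len ?leq_addr //; lia.
move=> [j ->]; case: (leqP j (len M)) => lj; [by left; exists j|right].
by rewrite (partial_sum_len hM (ltnW lj)); lia.
Qed.

(** If the entry at [len M] is not 1, the gap below [partial_sum M (len M)] makes this sum the
    conductor, and it is at least 2. Otherwise M is [1], with sum 1 and conductor 0, which is the
    case singled out in [CondN_star]. *)
Lemma CondN_starP c M : 1 <= c ->
  CondN_star c M <-> mult_seq M /\ partial_sum M (len M) = c.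
Proof.
move=> c1.
have psum_geq N n : mult_seq N -> partial_sum N (len N) <= n ->
    semigroup_of_seq N n.
  move=> hN Nn; rewrite semigroup_of_seqE //.
  exists (len N + (n - partial_sum N (len N))).
  by rewrite partial_sum_len ?leq_addr //; lia.
have len1 N : mult_seq N -> ent N (len N) = 1 ->
    partial_sum N (len N) = 1 /\ forall n, semigroup_of_seq N n.
  move=> hN N1; have [_ _ [l1|//]] := len_spec hN.
  have e1 : partial_sum N (len N) = 1.
    by move: N1; rewrite l1 partial_sumS partial_sum0.
  split=> // -[|n]; last by apply: psum_geq => //; rewrite e1.
  by rewrite semigroup_of_seqE //; exists 0; rewrite partial_sum0.
have gap N : mult_seq N -> ent N (len N) <> 1 ->
    ~ semigroup_of_seq N (partial_sum N (len N)).-1.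
  move=> hN N1; have [l1 _ _] := len_spec hN; rewrite semigroup_of_seqE //.
  by move=> [j]; apply: partial_sum_gap => //; exact: mult_seq_pos.
have mk N n : mult_seq N -> is_num_conductor (semigroup_of_seq N) n -> CondN n N.
  move=> hN cN; have A := Arf_partial_sums hN.
  exists (semigroup_of_seq N); split=> //; last by rewrite semigroup_of_seqE.
  rewrite semigroup_of_seqE //; split.
    by apply: Arf_submonoid => //; exists 0; rewrite partial_sum0.
  apply: (sub_finite_set (B := `I_(partial_sum N (len N)))); last exact: finite_II.
  move=> k /= nk; rewrite ltnNge; apply/negP => /(psum_geq _ _ hN).
  by rewrite semigroup_of_seqE.
have ent1P N := pselect (ent N (len N) = 1).
rewrite /CondN_star; split.
  case: eqP => [->|nc1] [S [_ _ [cS cmin] [hM eS]]]; split=> //; subst S.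
    case: (ent1P M) => [/(len1 _ hM)[] //|/(gap _ hM) []].
    exact: cS.
  case: (ent1P M) => [/(len1 _ hM)[_ M0]|/(gap _ hM) ng].
    have := cmin 0 (fun n _ => M0 n); lia.
  have := cmin _ (fun n => psum_geq M n hM).
  case: ltngtP => // cl _; case: ng; apply: cS; lia.
move=> [hM ec]; case: (ent1P M) => [M1|nM1].
  have [e1 M0] := len1 _ hM M1; rewrite -ec e1 eqxx; apply: mk => //.
  by split=> [n _|n _] //; apply: M0.
case: eqP => [c_1|_].
  have [l1 _ _] := len_spec hM; have M0 := mult_seq_pos hM (len M).-1.
  case: nM1; move: ec; rewrite -{1}(prednK l1) partial_sumS /ent; lia.
apply: mk => //; split=> [n|n nS]; first by rewrite -ec; apply: psum_geq.
rewrite -ec leqNgt; apply/negP => nl; apply: (gap _ hM nM1); apply: nS; lia.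
Qed.

(** * Semigroups with branches glued up to a common level *)

(* All [n h] are equal, or all are at least [p]. *)
Definition agree_below (I : Type) (p : nat) (n : I -> nat) : Prop :=
  forall h h' k, k < p -> (k < n h) = (k < n h').

Lemma agree_below_pred (I : Type) p (n : I -> nat) :
  agree_below p n -> agree_below p.-1 (fun h => (n h).-1).
Proof. by move=> an h h' k kp; have := an h h' k.+1; lia. Qed.

Lemma agree_below_succ (I : Type) p (n : I -> nat) :
  agree_below p.-1 n -> agree_below p (fun h => (n h).+1).
Proof. by move=> an h h' [|k] kp //; rewrite !ltnS; apply: an; lia. Qed.

Lemma ord2P (h : 'I_2) : h = ord0 \/ h = ord_max.
Proof. by case: h => [[|[|//]] h2]; [left|right]; apply: val_inj. Qed.

Lemma agree_below2 p (n : 'I_2 -> nat) :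
  agree_below p n <-> n ord0 = n ord_max \/ p <= minn (n ord0) (n ord_max).
Proof.
split=> [an|an h h' k kp].
  have := an ord0 ord_max (n ord0); have := an ord0 ord_max (n ord_max); lia.
by case: (ord2P h) => ->; case: (ord2P h') => ->; lia.
Qed.

(* The semigroup of the tree whose branches are all glued exactly up to level
   [p]; for [p = 0] it is the product of the semigroups of the [M h]. *)
Definition glued_semigroup (r p : nat) (M : 'I_r -> nat -> nat) : set 'rV[nat]_r :=
  [set v | exists2 n, agree_below p n & forall h, v ord0 h = partial_sum (M h) (n h)].

(** The sum condition of the tree in terms of counts: [n h] is the number of summands on branch h
    below level j + 1, and the first [p - j.+1] levels there are glued. The truncated subtraction
    unlinks the branches past level p. *)
Definition gluable (r p : nat) (M : 'I_r -> nat -> nat) : Prop :=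
  forall j, exists2 n, agree_below (p - j.+1) n
    & forall h, M h j = partial_sum (tail (M h) j.+1) (n h).

Section Glued.
Variable r : nat.
Implicit Types (M : 'I_r -> nat -> nat) (p : nat).

Lemma gluable_tail p M : gluable p.+1 M -> gluable p (fun h => tail (M h) 1).
Proof.
by move=> gM j; have [n an Mn] := gM j.+1; exists n.
Qed.

Lemma glued_semigroup0 p M : glued_semigroup p M 0%R.
Proof. by exists (fun=> 0) => // h; rewrite mxE partial_sum0. Qed.

Lemma rowD (x y : 'rV[nat]_r) h : (x + y)%R ord0 h = x ord0 h + y ord0 h.
Proof. by rewrite mxE. Qed.

(** Splits off the common root. As the first level is glued, the counts are either all zero or all
    positive. *)
Lemma glued_semigroupS p M :
  glued_semigroup p.+1 M =
  cons_semigroup (\row_h M h 0)%R (glued_semigroup p (fun h => tail (M h) 1)).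
Proof.
apply/seteqP; split=> [v [n an vn]|v [->|[x [n an xn] ->]]].
- case: (pselect (exists h0, n h0 = 0)) => [[h0 nh0]|nn0].
    left; apply/rowP => h; rewrite vn mxE.
    by case: (n h) (an h h0 0 isT) => [|k]; rewrite ?nh0 // partial_sum0.
  have n0 h : n h = (n h).-1.+1.
    by rewrite prednK // lt0n; apply/eqP => nh; apply: nn0; exists h.
  right; exists (\row_h partial_sum (tail (M h) 1) (n h).-1)%R.
    exists (fun h => (n h).-1); first exact: agree_below_pred an.
    by move=> h; rewrite mxE.
  by apply/rowP => h; rewrite rowD !mxE vn n0 partial_sum_cons.
- exact: glued_semigroup0.
- exists (fun h => (n h).+1); first exact: agree_below_succ.
  by move=> h; rewrite rowD xn mxE partial_sum_cons.
Qed.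

(** Induction on the glued levels: for p = 0 the semigroup is a product and each component is Arf;
    otherwise [gluable] at the root says that the root vector lies in the blow-up. *)
Lemma Arf_glued_semigroup p M :
  (forall h, mult_seq (M h)) -> gluable p M -> Arf (glued_semigroup p M).
Proof.
elim: p M => [|p IH] M hM gM.
  move=> a [n _ an]; split; first by exists n => // h; rewrite rowD mxE addn0.
  move=> x y [n1 _ e1] [n2 _ e2].
  have /choice [m em] h : exists j, (a + (x + y))%R ord0 h = partial_sum (M h) j.
    have [_ AD] := Arf_partial_sums (hM h) (ex_intro _ (n h) (erefl _)).
    rewrite !rowD an; apply: (AD (x ord0 h) (y ord0 h)).
      by exists (n1 h); rewrite -e1 rowD an.
    by exists (n2 h); rewrite -e2 rowD an.
  by exists m.
rewrite glued_semigroupS; apply: Arf_cons_semigroup.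
- by move=> x y z /rowP xz; apply/rowP => h; have := xz h; rewrite !rowD => /addIn.
- move=> x y /rowP xy; apply/rowP => h; have := xy h; rewrite rowD !mxE.
  by move=> /eqP; rewrite addn_eq0 => /andP[_ /eqP].
- apply: IH; last exact: gluable_tail.
  by move=> h; apply: mult_seq_tail.
- exact: glued_semigroup0.
- have [n an Mn] := gM 0; exists n; first by rewrite subn1 in an.
  by move=> h; rewrite mxE Mn.
Qed.

Lemma local_glued_semigroup p M : 1 <= p -> (forall h n, 0 < M h n) ->
  local_semigroup (glued_semigroup p M).
Proof.
move=> p1 M0 x [n an xn] [i xi]; apply/rowP => h; rewrite mxE xn.
have ni : n i = 0.
  by apply: (partial_sum_inj (M0 i)); rewrite -xn xi partial_sum0.
by case: (n h) (an h i 0 p1) => [|k]; rewrite ?ni // partial_sum0.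
Qed.

Lemma glued_semigroup_large p M (v : 'rV[nat]_r) : (forall h, mult_seq (M h)) ->
  (forall h, partial_sum (M h) (maxn p (len (M h))) <= v ord0 h) ->
  glued_semigroup p M v.
Proof.
move=> hM vM; have /choice [n vn] h : exists k, p <= k /\ v ord0 h = partial_sum (M h) k.
  exists (maxn p (len (M h)) + (v ord0 h - partial_sum (M h) (maxn p (len (M h))))).
  split; first exact: leq_trans (leq_maxl _ _) (leq_addr _ _).
  have := vM h; have := partial_sum_len (hM h) (leq_maxr p (len (M h))).
  rewrite [partial_sum _ (_ + _)]partial_sum_len //; lia.
exists n => [h h' k kp|h]; last by have [] := vn h.
by have [] := vn h; have [] := vn h'; lia.
Qed.

Lemma good_glued_semigroup p M :
  (forall h, mult_seq (M h)) -> gluable p M -> good_semigroup (glued_semigroup p M).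
Proof.
move=> hM gM; have M0 h := mult_seq_pos (hM h).
have psum_min h j k : minn (partial_sum (M h) j) (partial_sum (M h) k) =
    partial_sum (M h) (minn j k).
  by case: (leqP j k) => [|/ltnW] /(leq_partial_sum (M h)) => [/minn_idPl|/minn_idPr].
split.
- apply: Arf_submonoid; [exact: glued_semigroup0 | exact: Arf_glued_semigroup].
- move=> a b [n an aE] [m am bE]; exists (fun h => minn (n h) (m h)).
    by move=> h h' k kp; have := an h h' k kp; have := am h h' k kp; lia.
  by move=> h; rewrite mxE aE bE psum_min.
- move=> a b i [n an aE] [m am bE] abi.
  have nmi : n i = m i by apply: (partial_sum_inj (M0 i)); rewrite -aE -bE.
  (* A common count below p on branch i forces all counts of a and b to coincide, so a = b, and one
     more level is added on every branch. *)
  case: (ltnP (n i) p) => [nip|pni].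
    have ni h : n h = n i by have := an h i (n i); have := an h i (n i).-1; lia.
    have mi h : m h = n i by have := am h i (n i); have := am h i (n i).-1; lia.
    exists (\row_h partial_sum (M h) (n i).+1)%R; split.
    + by exists (fun=> (n i).+1) => // h; rewrite mxE.
    + by rewrite mxE aE ltn_partial_sum.
    + move=> h _; rewrite mxE aE bE ni mi minnn; split=> //.
      exact: leq_partial_sum.
  have pn h : p <= n h by have := an h i p.-1; lia.
  have pm h : p <= m h by have := am h i p.-1; lia.
  (* All counts are at least p, so the branches vary independently: one step up on branch i, the
     minimum elsewhere. *)
  pose k h := if h == i then (n i).+1 else minn (n h) (m h).
  exists (\row_h partial_sum (M h) (k h))%R; split.
  + exists k => [h h' l lp|h]; last by rewrite mxE.
    suff pk g : p <= k g by have := pk h; have := pk h'; lia.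
    by rewrite /k; case: eqP => _; [lia | rewrite leq_min pn pm].
  + by rewrite mxE aE /k eqxx ltn_partial_sum.
  + by move=> h /negPf hi; rewrite mxE aE bE /k hi psum_min.
- exists (\row_h partial_sum (M h) (maxn p (len (M h))))%R; split=> [|g].
    by apply: glued_semigroup_large => // h; rewrite mxE.
  by apply: glued_semigroup_large => // h; rewrite rowD mxE leq_addr.
Qed.

End Glued.

Lemma conductor_glued_semigroup p (M : 'I_2 -> nat -> nat) (c : 'rV[nat]_2) :
  1 <= p -> (forall h, mult_seq (M h)) ->
  is_conductor (glued_semigroup p M) c <->
  forall h, c ord0 h = partial_sum (M h) (maxn p (len (M h))).
Proof.
move=> p1 hM; pose C : 'rV[nat]_2 := (\row_h partial_sum (M h) (maxn p (len (M h))))%R.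
have largeC : forall g, glued_semigroup p M (C + g)%R.
  by move=> g; apply: glued_semigroup_large => // h; rewrite rowD mxE leq_addr.
have minC d : (forall g, glued_semigroup p M (d + g)%R) -> forall h, C ord0 h <= d ord0 h.
  move=> Sd h; rewrite mxE; apply: partial_sum_len_le => // g.
  have [h' hh'] : exists h' : 'I_2, h' != h.
    by case: (eqVneq h ord0) => [->|]; [exists ord_max | exists ord0; rewrite eq_sym].
  (* Adding [partial_sum (M i) p] on the other branch makes its count at least p. Agreement then
     forces a count of at least p on h, whatever g is. *)
  have [n an dn] := Sd (\row_i if i == h then g else partial_sum (M i) p)%R.
  exists (n h); last by rewrite -dn rowD mxE eqxx.
  have := dn h'; rewrite rowD mxE (negPf hh') => dh'.
  have pn' : p <= n h'.
    rewrite leqNgt -(ltn_partial_sum _ _ (mult_seq_pos (hM h'))) -dh' -leqNgt.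
    exact: leq_addl.
  by have := an h h' p.-1; lia.
split=> [[Sc cmin] h|cC].
  have Ch : C ord0 h = partial_sum (M h) (maxn p (len (M h))) by rewrite mxE.
  by apply/eqP; rewrite eqn_leq -{1}Ch (cmin C largeC) -Ch minC.
have -> : c = C by apply/rowP => h; rewrite cC mxE.
by split.
Qed.

(** * Finite subtrees and their node counts *)

Definition branch_seq (r : nat) (T : tree r) (h : 'I_r) : nat -> nat :=
  fun l => T h l ord0 h.

(* [n h] is the number of nodes on branch [h] of a finite subtree rooted in the
   node of branch [i] at level [j.+1]. *)
Definition profile (r : nat) (T : tree r) (i : 'I_r) (j : nat) (n : 'I_r -> nat) :=
  (forall h h' k, T h (j + k) = T h' (j + k) -> (k < n h) = (k < n h')) /\
  (forall h, 0 < n h <-> T h j = T i j).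

Section Subtrees.
Variables (r : nat) (T : tree r).
Implicit Types (i h : 'I_r) (j k : nat) (N : {fset nat * 'rV[nat]_r}).

(** A subtree contains the parents of its non-root nodes, so it meets each branch in an initial run
    of levels; [n h] is the length of that run. *)
Lemma subtree_profile i j N :
  (forall i h j, T i j.+1 = T h j.+1 -> T i j = T h j) ->
  subtree T i j.+1 N ->
  exists2 n, profile T i j n &
    forall h k, (node T h (j.+1 + k) \in N) = (k < n h).
Proof.
move=> glue [rootN NP].
have parent h k : node T h (j.+1 + k.+1) \in N -> node T h (j.+1 + k) \in N.
  move=> kN; have [] := NP _ kN.
    by move=> [] /eqP; rewrite -[in X in _ == X](addn0 j) eqn_add2l.
  (* The parent is given along some branch h' through the node; branches glued at a level are glued
     one level earlier, so it is also the parent along h. *)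
  move=> h' [k' [jk' [ek eT] h'N]]; have {}ek : k' = j.+1 + k by lia.
  subst k'; rewrite /node; suff -> : ent (T h) (j.+1 + k) = ent (T h') (j.+1 + k) by [].
  by move: eT; rewrite /ent addnS /=; apply: glue.
have /choice [n nP] h : exists n, forall k, (node T h (j.+1 + k) \in N) = (k < n).
  have exk : exists k, node T h (j.+1 + k) \notin N.
    exists (\max_(x <- N) x.1); apply/negP => xN.
    have := @leq_bigmax_seq _ (enum_fset N) xpredT (fun x : nat * 'rV[nat]_r => x.1) _ xN isT.
    by rewrite /=; lia.
  exists (ex_minn exk); case: ex_minnP => m mN mmin k; apply/idP/idP.
    have down l : node T h (j.+1 + (k - l)) \in N -> node T h (j.+1 + (k - l.+1)) \in N.
      case: (leqP k l) => kl; first by have -> : k - l.+1 = k - l by lia.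
      have -> : k - l = (k - l.+1).+1 by lia.
      exact: parent.
    move=> kN; rewrite ltnNge; apply: contra mN => mk.
    rewrite -(subKn mk); elim: (k - m) => [|l]; [by rewrite subn0 | exact: down].
  by apply: contraTT => /mmin; rewrite -leqNgt.
exists n; last by [].
split=> [h h' k e|h]; first by rewrite -!nP /node /ent /= e.
rewrite -nP addn0; split=> [hN|e]; last by rewrite /node /ent /= e.
apply: contrapT => ne; have [|h' [k [jk [ek _] _]]] := NP _ hN; last lia.
by case.
Qed.

(** Only nodes on branch h have a nonzero component h, and these are the first n ones from level j +
    1 on. *)
Lemma sum_subtree h j N n :
  (forall i h j, T i j ord0 h = 0 <-> T i j <> T h j) ->
  (forall x, x \in N -> exists h k, x = node T h (j.+1 + k)) ->
  (forall k, (node T h (j.+1 + k) \in N) = (k < n)) ->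
  (\sum_(x <- N) x.2)%R ord0 h = partial_sum (tail (branch_seq T h) j) n.
Proof.
move=> zero NT Nn.
have nzE i k : (T i k ord0 h != 0) = `[< T i k = T h k >].
  apply/idP/asboolP => [/eqP nz|e]; last by apply/eqP => /(zero i h k).
  by apply: contrapT => /(zero i h k).
pose s := [seq node T h (j.+1 + k) | k <- iota 0 n].
have s_uniq : uniq s by rewrite map_inj_uniq ?iota_uniq // => k l [] /addnI.
have perm_s : perm_eq [seq x <- N | (x : nat * 'rV[nat]_r).2 ord0 h != 0] s.
  apply: uniq_perm => //; first by rewrite filter_uniq ?fset_uniq.
  move=> x; rewrite mem_filter; apply/andP/mapP => [[xh xN]|[k kn ->]].
    have [h' [k ex]] := NT x xN; exists k.
      rewrite mem_iota /= add0n -Nn; move: xN xh; rewrite ex /=.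
      by rewrite /node /ent /= nzE => + /asboolP <-.
    by move: xh; rewrite ex /node /ent /= nzE => /asboolP ->.
  move: kn; rewrite mem_iota /= add0n -Nn => ->; split=> //.
  by rewrite /ent /= nzE; apply/asboolP.
rewrite summxE (bigID (fun x : nat * 'rV[nat]_r => x.2 ord0 h == 0)) /=.
rewrite big1 ?add0r; last by move=> x /eqP.
rewrite -big_filter (perm_big _ perm_s) big_map partial_sumE.
by rewrite -[n in iota 0 n]subn0 -/(index_iota 0 n) big_mkord.
Qed.

Lemma subtree_sumP i j v :
  (forall i h j, T i j.+1 = T h j.+1 -> T i j = T h j) ->
  (forall i h j, T i j ord0 h = 0 <-> T i j <> T h j) ->
  (exists N, subtree T i j.+1 N /\ v = (\sum_(x <- N) x.2)%R) <->
  exists2 n, profile T i j n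
    & forall h, v ord0 h = partial_sum (tail (branch_seq T h) j) (n h).
Proof.
move=> glue zero; split.
  move=> [N [sN ->]]; have [n pn nN] := subtree_profile glue sN.
  exists n => // h; apply: sum_subtree => // x xN.
  have [_ NP] := sN; case: (pselect (x = node T i j.+1)) => [->|/(NP x xN)].
    by exists i, 0; rewrite addn0.
  move=> [h' [k [jk -> _]]]; exists h', (k.+1 - j.+1).
  by rewrite subnKC // ltnW.
move=> [n [ng n0] vn].
(* The subtree takes the first [n h] nodes on each branch; passing to a finite set merges the nodes
   shared by glued branches. *)
pose s := flatten [seq [seq node T h (j.+1 + k) | k <- iota 0 (n h)] | h <- enum 'I_r].
pose N := [fset x in s]%fset.
have NP x : reflect (exists2 h, true & exists2 k, k < n h & x = node T h (j.+1 + k)) (x \in N).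
  rewrite inE /=; apply: (iffP flatten_mapP) => [[h _ /mapP[k]]|[h _ [k kn ->]]].
    by rewrite mem_iota /= add0n => kn ->; exists h => //; exists k.
  by exists h; rewrite ?mem_enum //; apply: map_f; rewrite mem_iota.
have nN h k : (node T h (j.+1 + k) \in N) = (k < n h).
  apply/NP/idP => [[h' _ [k' kn [/addnI ek]]]|kn]; last by exists h => //; exists k.
  by subst k'; rewrite /ent /= => /ng ->.
have NT x : x \in N -> exists h k, x = node T h (j.+1 + k).
  by move=> /NP[h _ [k _ ->]]; exists h, k.
exists N; split; last first.
  by apply/rowP => h; rewrite vn (sum_subtree zero NT (nN h)).
split=> [|x /NP[h _ [[|k] kn ->]]].
- by have := nN i 0; rewrite addn0 => ->; apply/n0.
- by rewrite addn0; have /n0 := kn; rewrite /node /ent /= => ->.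
- move=> _; exists h, (j.+1 + k); split; rewrite ?addnS ?leq_addr //.
  by rewrite nN; lia.
Qed.

(** Adding the root to both sides turns a sum without the root into a full subtree sum equal to
    twice the node. *)
Lemma tree_sumP i j :
  (forall i h j, T i j.+1 = T h j.+1 -> T i j = T h j) ->
  (forall i h j, T i j ord0 h = 0 <-> T i j <> T h j) ->
  (exists2 N, subtree T i j.+1 N
    & T i j = (\sum_(x <- N | x != node T i j.+1) x.2)%R) <->
  exists2 n, profile T i j n
    & forall h, T i j ord0 h + T i j ord0 h = partial_sum (tail (branch_seq T h) j) (n h).
Proof.
move=> glue zero.
have sumN N : subtree T i j.+1 N ->
    (\sum_(x <- N) x.2 = T i j + \sum_(x <- N | x != node T i j.+1) x.2)%R.
  by move=> [rN _]; rewrite (bigD1_seq (node T i j.+1)) //= fset_uniq.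
have H := subtree_sumP i j (T i j + T i j)%R glue zero; split.
  move=> [N sN eN]; have [|n pn vn] := H.1; last by exists n => // h; rewrite -vn rowD.
  by exists N; split=> //; rewrite sumN // -eN.
move=> [n pn vn]; have [|N [sN /rowP eN]] := H.2.
  by exists n => // h; rewrite rowD vn.
exists N => //; apply/rowP => h; apply/(@addnI (T i j ord0 h)).
by rewrite -!rowD eN sumN.
Qed.

End Subtrees.

(** * Trees with two branches *)

Definition pair_seq (M1 M2 : nat -> nat) (h : 'I_2) : nat -> nat :=
  if h == ord0 then M1 else M2.

(** The counts at level k are forced to be [sum_index] minus k. Agreement below p - k then says that
    the two indices are equal or both at least p. *)
Lemma gluable_pairP p M1 M2 : mult_seq M1 -> mult_seq M2 ->
  gluable p (pair_seq M1 M2) <-> le_oo p (Comp M1 M2).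
Proof.
move=> h1 h2; rewrite le_oo_CompP //; split=> [gM [|k] // _ sk|sM k].
  have [n /agree_below2 an Mn] := gM k; move: sk.
  have -> := sum_index_eq (mult_seq_pos h1) (Mn ord0).
  have -> := sum_index_eq (mult_seq_pos h2) (Mn ord_max).
  by case: an => [->|] //; lia.
have [t1 e1 M1t] := sum_indexP k h1; have [t2 e2 M2t] := sum_indexP k h2.
exists (fun h => if h == ord0 then t1 else t2).
  apply/agree_below2 => /=; have := sM k.+1 isT; rewrite e1 e2.
  by case: (eqVneq t1 t2) => [|/eqP t12 H]; [left | right; have := H _; lia].
by move=> h; case: (ord2P h) => ->.
Qed.

Section Tree2.
Variables (M1 M2 : nat -> nat) (p : nat).
Let M := pair_seq M1 M2.

Lemma tree2E i j h :
  tree2 M1 M2 p i j ord0 h = if (j < p) || (h == i) then M h j else 0.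
Proof. by rewrite mxE /M /pair_seq; case: (h == ord0). Qed.

Lemma branch_seq_tree2 h : branch_seq (tree2 M1 M2 p) h = M h.
Proof. by apply: funext => j; rewrite /branch_seq tree2E eqxx orbT. Qed.

Hypothesis M0 : forall h n, 0 < M h n.

Lemma tree2_eq h i j :
  tree2 M1 M2 p h j = tree2 M1 M2 p i j <-> (j < p) || (h == i).
Proof.
split=> [/rowP /(_ h)|].
  by rewrite !tree2E eqxx orbT; case: orP => // _ e; have := M0 h j; rewrite e.
by move=> /orP[jp|/eqP -> //]; apply/rowP => g; rewrite !tree2E jp.
Qed.

Lemma tree2_glue i h j :
  tree2 M1 M2 p i j.+1 = tree2 M1 M2 p h j.+1 -> tree2 M1 M2 p i j = tree2 M1 M2 p h j.
Proof. by move=> /tree2_eq H; apply/tree2_eq; move: H => /orP[/ltnW|] ->; rewrite ?orbT. Qed.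

Lemma tree2_zero i h j :
  tree2 M1 M2 p i j ord0 h = 0 <-> tree2 M1 M2 p i j <> tree2 M1 M2 p h j.
Proof.
rewrite tree2E eq_sym; split=> [e /tree2_eq H|H].
  by move: e; rewrite H => e; have := M0 h j; rewrite e.
by case: ifP => // /tree2_eq.
Qed.

Lemma profile_tree2 i j n :
  profile (tree2 M1 M2 p) i j n <->
  agree_below (p - j) n /\ forall h, (0 < n h) = (j < p) || (h == i).
Proof.
split=> [[ng n0]|[an n0]].
  split=> [h h' k kp|h]; first by apply/ng/tree2_eq; apply/orP; left; lia.
  by apply/idP/idP => [/n0 /tree2_eq|/tree2_eq /n0].
split=> [h h' k /tree2_eq /orP[jk|/eqP -> //]|h]; first by apply: an; lia.
by rewrite n0; split=> /tree2_eq.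
Qed.

Lemma semigroup_of_tree2 : 1 <= p ->
  semigroup_of_tree (tree2 M1 M2 p) = glued_semigroup p M.
Proof.
move=> p1; apply/seteqP; split=> v.
  move=> [->|[i vN]]; first exact: glued_semigroup0.
  have [n /profile_tree2[an _] vn] := (subtree_sumP i 0 v tree2_glue tree2_zero).1 vN.
  by exists n; [rewrite subn0 in an | move=> h; rewrite vn branch_seq_tree2].
move=> [n an vn]; case: (posnP (n ord0)) => [n0|n0].
  left; apply/rowP => h; rewrite vn mxE.
  by case: (n h) (an h ord0 0 p1) => [|k]; rewrite ?n0 // partial_sum0.
right; exists ord0; apply: (subtree_sumP ord0 0 v tree2_glue tree2_zero).2.
exists n; last by move=> h; rewrite vn branch_seq_tree2.
by apply/profile_tree2; rewrite subn0 p1; split=> // h; rewrite (an h ord0).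
Qed.

Lemma mult_tree_tree2 : 1 <= p -> (forall h, mult_seq (M h)) -> gluable p M ->
  mult_tree (tree2 M1 M2 p).
Proof.
move=> p1 hM gM; split.
- by move=> i h; apply/tree2_eq; rewrite p1.
- by move=> i h [//|j] _; apply: tree2_glue.
- have /choice [N HN] h : exists N, forall n, N <= n -> M h n = 1.
    by have /mult_seqP [] := hM h.
  exists (N ord0 + N ord_max + p).+1 => -[//|m] mN i; rewrite /ent /=.
  apply/rowP => h; rewrite tree2E mxE eqxx /= ltnNge.
  have -> /= : p <= m by lia.
  by case: eqP => // _; rewrite HN //; case: (ord2P h) => ->; lia.
- by move=> i h [//|j] _; apply: tree2_zero.
- move=> i [//|j] _; apply/(tree_sumP i j tree2_glue tree2_zero).
  have [m am Mm] := gM j.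
  (* The successor counts the root itself; a branch not through the node has count 0. *)
  exists (fun h => if (j < p) || (h == i) then (m h).+1 else 0).
    apply/profile_tree2; split=> [|h]; last by case: ifP.
    case: ltnP => jp; last by move=> h h' k; lia.
    by apply: agree_below_succ; rewrite -subnS.
  move=> h; rewrite branch_seq_tree2 tree2E; case: ifP => _; last by rewrite partial_sum0.
  by rewrite tail_partial_sum_cons -Mm.
Qed.

End Tree2.

(** * Branch sequences and gluing level of a multiplicity tree *)

Lemma mult_tree_glue (r : nat) (T : tree r) : mult_tree T ->
  forall i h j, T i j.+1 = T h j.+1 -> T i j = T h j.
Proof. by move=> hT i h j; apply: (tree_glue hT (j := j.+1)). Qed.

Lemma mult_tree_zero (r : nat) (T : tree r) : mult_tree T ->
  forall i h j, T i j ord0 h = 0 <-> T i j <> T h j.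
Proof. by move=> hT i h j; apply: (tree_zero hT i h (j := j.+1)). Qed.

Lemma mult_tree_profile (r : nat) (T : tree r) i j : mult_tree T ->
  exists2 n, profile T i j n & forall h,
    T i j ord0 h + T i j ord0 h = partial_sum (tail (branch_seq T h) j) (n h).
Proof.
move=> hT; apply/(tree_sumP i j (mult_tree_glue hT) (mult_tree_zero hT)).
exact: (tree_sum hT i (j := j.+1)).
Qed.

(** Component i of the sum condition at a node of branch i is the sum condition of the sequence,
    once the root's own contribution is cancelled. *)
Lemma mult_seq_branch (r : nat) (T : tree r) i : mult_tree T -> mult_seq (branch_seq T i).
Proof.
move=> hT; have M0 n : 0 < branch_seq T i n.
  rewrite lt0n; apply/eqP => Tn.
  by have := (mult_tree_zero hT i i n).1 Tn.
apply/mult_seqP; split=> //.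
  have [L HL] := tree_unit hT; exists L => n Ln.
  by have := HL n.+1 (leqW Ln) i; rewrite /ent /branch_seq /= => ->; rewrite mxE !eqxx.
move=> n; have [m [_ m0] Tm] := mult_tree_profile i n hT.
have mi : m i = (m i).-1.+1 by rewrite prednK //; apply/m0.
exists (m i).-1; apply: (@addnI (branch_seq T i n)).
by rewrite [LHS]Tm mi tail_partial_sum_cons.
Qed.

Lemma mult_tree2P (T : tree 2) :
  mult_tree T <->
  exists M1 M2 p, [/\ T = tree2 M1 M2 p, mult_seq M1, mult_seq M2, 1 <= p
    & le_oo p (Comp M1 M2)].
Proof.
split=> [hT|[M1 [M2 [p [-> h1 h2 p1 /(gluable_pairP p h1 h2) gM]]]]]; last first.
  have hM h : mult_seq (pair_seq M1 M2 h) by rewrite /pair_seq; case: ifP.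
  by apply: mult_tree_tree2 => // h n; apply: mult_seq_pos.
have glue := mult_tree_glue hT; have zero := mult_tree_zero hT.
pose M := branch_seq T; have hM h : mult_seq (M h) := mult_seq_branch h hT.
have unglued : exists j, T ord0 j != T ord_max j.
  have [L HL] := tree_unit hT; exists L.
  have TL i := HL L.+1 (leqnSn L) i; rewrite /ent /= in TL.
  by rewrite !TL; apply/eqP => /rowP /(_ ord0); rewrite !mxE.
(* The least 0-based argument at which the branches differ equals the highest 1-based level at which
   they are glued. *)
pose p := ex_minn unglued.
have pP j : j < p <-> T ord0 j = T ord_max j.
  rewrite /p; case: ex_minnP => m mN mmin; split=> [jm|e].
    by apply/eqP; apply: contraLR jm => /mmin; rewrite -leqNgt.
  rewrite ltnNge; apply: contra mN => mj; apply/eqP; move: e.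
  by rewrite -(subnKC mj); elim: (j - m) => [|k IH]; rewrite ?addn0 // addnS => /glue.
have TE i h j : T i j = T h j <-> (j < p) || (h == i).
  case: (ord2P i) => ->; case: (ord2P h) => ->; rewrite ?eqxx ?orbT ?orbF; first by [].
  - by rewrite -pP.
  - by rewrite pP; split=> ->.
  - by [].
have p1 : 1 <= p by apply/pP; apply: (tree_root hT).
exists (M ord0), (M ord_max), p.
have eT : T = tree2 (M ord0) (M ord_max) p.
  apply: funext => i; apply: funext => j; apply/rowP => h.
  have -> : tree2 (M ord0) (M ord_max) p i j ord0 h = if (j < p) || (h == i) then M h j else 0.
    by rewrite tree2E /pair_seq; case: (ord2P h) => ->.
  by case: ifP => [/TE ->|/negP ne] //; apply/zero => /TE.
split=> //; apply/gluable_pairP => // j.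
have pM h : pair_seq (M ord0) (M ord_max) h = M h by case: (ord2P h) => ->.
have [n [ng n0] Tn] := mult_tree_profile ord0 j hT.
case: (ltnP j p) => jp.
  have nS h : n h = (n h).-1.+1.
    by rewrite prednK //; apply/n0/TE; rewrite jp.
  exists (fun h => (n h).-1).
    rewrite subnS; apply: agree_below_pred => h h' k kp; apply/ng/TE; lia.
  move=> h; rewrite pM; apply: (@addnI (M h j)).
  by rewrite {2}/M -tail_partial_sum_cons -nS -Tn /M /branch_seq (TE ord0 h j).2 ?jp.
(* Here [p - j.+1] is 0, so each branch may supply its own count. *)
have /choice [m mP] h : exists k, M h j = partial_sum (tail (M h) j.+1) k.
  by have /mult_seqP [_ _ /(_ j)] := hM h.
by exists m => [h h' k|h]; [lia | rewrite pM].
Qed.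

(** * Trees of given conductor and the four families *)

Lemma Cond2P (T : tree 2) (c : 'rV[nat]_2) :
  Cond c T <->
  exists M1 M2 p, [/\ T = tree2 M1 M2 p, mult_seq M1 /\ mult_seq M2, 1 <= p,
    le_oo p (Comp M1 M2)
    & c ord0 ord0 = partial_sum M1 (maxn p (len M1)) /\
      c ord0 ord_max = partial_sum M2 (maxn p (len M2))].
Proof.
split=> [[S [_ _ _ cS [/mult_tree2P [M1 [M2 [p [eT h1 h2 p1 pC]]]] eS]]]|].
  have hM h : mult_seq (pair_seq M1 M2 h) by rewrite /pair_seq; case: ifP.
  exists M1, M2, p; split=> //.
  rewrite eS eT semigroup_of_tree2 // in cS; last by move=> h n; apply: mult_seq_pos.
  by move/(conductor_glued_semigroup c p1 hM): cS => cS; split; rewrite cS.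
move=> [M1 [M2 [p [eT [h1 h2] p1 pC [e1 e2]]]]].
have hM h : mult_seq (pair_seq M1 M2 h) by rewrite /pair_seq; case: ifP.
have M0 h n : 0 < pair_seq M1 M2 h n by apply: mult_seq_pos.
have gM : gluable p (pair_seq M1 M2) by apply/gluable_pairP.
exists (glued_semigroup p (pair_seq M1 M2)); split.
- exact: good_glued_semigroup.
- exact: local_glued_semigroup.
- exact: Arf_glued_semigroup.
- by apply/(conductor_glued_semigroup c p1 hM) => h; case: (ord2P h) => ->.
- split; last by rewrite eT semigroup_of_tree2.
  by apply/mult_tree2P; exists M1, M2, p.
Qed.

Unset Implicit Arguments.

Theorem mainTheorem2 (c : 'rV[nat]_2)
    (hc1 : 1 <= c ord0 ord0) (hc2 : 1 <= c ord0 ord_max) :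
  Cond c = S1 c `|` S21 c `|` S22 c `|` S3 c.
Proof.
have psum_pos M : mult_seq M -> 1 <= partial_sum M (len M).
  move=> hM; have [l1 _ _] := len_spec hM.
  by rewrite -(partial_sum0 M) ltn_partial_sum //; exact: mult_seq_pos.
have psum_max M p : mult_seq M -> len M <= p ->
    partial_sum M (maxn p (len M)) = partial_sum M (len M) + (p - len M).
  by move=> hM lp; rewrite (maxn_idPl lp) partial_sum_len.
have len1 M : mult_seq M -> 1 <= len M by case/len_spec.
apply/seteqP; split=> T.
  move=> /Cond2P [M1 [M2 [p [eT [h1 h2] p1 pC [e1 e2]]]]].
  have [s1 s2] := (psum_pos _ h1, psum_pos _ h2).
  have C1 : CondN_star (partial_sum M1 (len M1)) M1 by apply/CondN_starP.
  have C2 : CondN_star (partial_sum M2 (len M2)) M2 by apply/CondN_starP.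
  case: (leqP p (len M1)) => l1; case: (leqP p (len M2)) => l2.
  - do 3!left; exists M1, M2, p; split=> //.
      by rewrite e1 (maxn_idPr l1).
    by rewrite e2 (maxn_idPr l2).
  (* Here k is the partial sum of M2 up to its length, and c[2] - k = p - [len M2] counts the
     trailing entries 1 up to level p. *)
  - do 2!left; right; exists (partial_sum M2 (len M2)).
      by move: e2; rewrite psum_max // 1?ltnW // /= s2 => ->; lia.
    move: e2; rewrite psum_max // 1?ltnW // => e2.
    exists M1, M2, p; split=> //; first by rewrite e1 (maxn_idPr l1).
    by rewrite e2; lia.
  - left; right; exists (partial_sum M1 (len M1)).
      by move: e1; rewrite psum_max // 1?ltnW // /= s1 => ->; lia.
    move: e1; rewrite psum_max // 1?ltnW // => e1.
    exists M1, M2, p; split=> //; first by rewrite e2 (maxn_idPr l2).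
    by rewrite e1; lia.
  - right; move: e1 e2; rewrite !psum_max // 1?ltnW // 1?ltnW // => e1 e2.
    exists (partial_sum M1 (len M1)); first by rewrite /= s1 e1; lia.
    exists (partial_sum M2 (len M2)); first by rewrite /= s2 e2; lia.
    exists M1, M2, p; split=> //; first by rewrite e1; lia.
    by split=> //; rewrite e2; lia.
move=> H; apply/Cond2P; move: H.
move=> [[[|]|]|].
- move=> [M1 [M2 [p [eT /CondN_starP [//|h1 e1] /CondN_starP [//|h2 e2] p1 [pC l1 l2]]]]].
  by exists M1, M2, p; split=> //; rewrite (maxn_idPr l1) (maxn_idPr l2) e1 e2.
- move=> [k /andP[k1 kc] [M1 [M2 [p]]]].
  move=> [eT /CondN_starP [//|h1 e1] /CondN_starP [//|h2 e2] ep [l1 pC]].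
  (* The length is at least 1, hence so is p. *)
  have := len1 _ h2; exists M1, M2, p; split=> //; first lia.
  by split; [rewrite (maxn_idPr l1) | rewrite psum_max //; lia].
- move=> [k /andP[k1 kc] [M1 [M2 [p]]]].
  move=> [eT /CondN_starP [//|h1 e1] /CondN_starP [//|h2 e2] ep [l2 pC]].
  have := len1 _ h1; exists M1, M2, p; split=> //; first lia.
  by split; [rewrite psum_max //; lia | rewrite (maxn_idPr l2)].
- move=> [k /andP[k1 kc] [k' /andP[k1' kc'] [M1 [M2 [p]]]]].
  move=> [eT /CondN_starP [//|h1 e1] /CondN_starP [//|h2 e2] ep [ep' pC]].
  have := len1 _ h1; exists M1, M2, p; split=> //; first lia.
  by split; rewrite psum_max //; lia.
Qed.
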